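(* Let $R$ be a commutative ring and $n\ge3$. Let $(v_1,w_1),(v_2,w_2)$ be points of the unit sphere $U_{2n-1}(R)=\{(v,w)\in H(R^n): v\cdot w^{\intercal}=1\}$. Then $(v_1,w_1)$ and $(v_2,w_2)$ lie in the same $\operatorname{Epin}_{2n}(R)$-orbit if and only if $v_1$ and $v_2$ lie in the same $E_n(R)$-orbit (i.e. $v_2=v_1\varepsilon$ for some $\varepsilon\in E_n(R)$). Consequently $v\mapsto(v,w)$ (for any $w$ with $v\cdot w^{\intercal}=1$) induces a bijection $$Um_n(R)/E_n(R)\;\longleftrightarrow\;U_{2n-1}(R)/\operatorname{Epin}_{2n}(R)=U_{2n-1}(R)/EO_{2n}(R).$$
   Context: $Um_n(R)$ is the set of unimodular rows $v\in R^n$ (there is $w\in R^n$ with $v\cdot w^{\intercal}=1$); $E_n(R)\subseteq GL_n(R)$, generated by elementary matrices $I+\lambda e_{ij}$ ($i\ne j$), acts on rows on the right. $H(R^n)=R^n\oplus(R^n)^*$ with $q(v,w)=v\cdot w^{\intercal}$ and basis $e_1,\dots,e_n,f_1,\dots,f_n$. Let $\partial=(1\ n+1)\cdots(n\ 2n)$ and $E^o_{ij}(\lambda)=I_{2n}+\lambda(e_{ij}-e_{\partial(j)\partial(i)})$ for $1\le i\ne j\le 2n$; $EO_{2n}(R)$ is the group they generate, acting on $H(R^n)$ via matrices in the ordered basis $(e_1,\dots,e_n,f_1,\dots,f_n)$. $\mathrm{Cl}=\mathrm{Cl}_0\oplus\mathrm{Cl}_1$ is the Clifford algebra of $(H(R^n),q)$,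 $x\mapsto x^*$ its canonical involution (identity on $H(R^n)$). $\operatorname{Spin}_{2n}(R)=\{x\in\mathrm{Cl}_0: xx^*=1,\ xH(R^n)x^{-1}=H(R^n)\}$ acts on $H(R^n)$ by $\pi(g)(u)=gug^{-1}$, and $\operatorname{Epin}_{2n}(R)=\pi^{-1}(EO_{2n}(R))$. *)

(* Defs.v *)
From HB Require Import structures.
From mathcomp Require Import all_boot all_order all_algebra.
Set Implicit Arguments. Unset Strict Implicit. Unset Printing Implicit Defensive.
Import GRing.Theory.
Local Open Scope ring_scope.

Definition elem_mx (R : pzRingType) (n : nat) (i j : 'I_n) (a : R) : 'M[R]_n :=
  1%:M + a *: delta_mx i j.

(* Monoid generated by the elementary matrices; since the inverse of an
   elementary matrix is elementary, this is the group E_n(R). *)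
Inductive En (R : pzRingType) (n : nat) : 'M[R]_n -> Prop :=
| En1 : En 1%:M
| EnM (M : 'M[R]_n) (i j : 'I_n) (a : R) :
    En M -> i != j -> En (M *m elem_mx i j a).

Definition unimodular (R : pzRingType) (n : nat) (v : 'rV[R]_n) : Prop :=
  exists w : 'rV[R]_n, (v *m w^T) 0 0 = 1.

(* ---------- hyperbolic space H(R^n) = R^n (+) (R^n)^*, as 'rV_(n+n),
   coordinates in the ordered basis e_1..e_n,f_1..f_n ---------- *)
Definition hq (R : pzRingType) (n : nat) (u : 'rV[R]_(n + n)) : R :=
  (lsubmx u *m (rsubmx u)^T) 0 0.

Definition unit_sphere (R : pzRingType) (n : nat) (u : 'rV[R]_(n + n)) : Prop :=
  hq u = 1.

Definition hdual (n : nat) (k : 'I_(n + n)) : 'I_(n + n) :=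
  match split k with
  | inl a => rshift n a
  | inr b => lshift n b
  end.

Definition eo_elem (R : pzRingType) (n : nat) (i j : 'I_(n + n)) (a : R)
  : 'M[R]_(n + n) :=
  1%:M + a *: (delta_mx i j - delta_mx (hdual j) (hdual i)).

(* EO_{2n}(R): generated by the E^o_ij(lambda), i <> j (closed under inverses) *)
Inductive EO (R : pzRingType) (n : nat) : 'M[R]_(n + n) -> Prop :=
| EO1 : EO 1%:M
| EOM (M : 'M[R]_(n + n)) (i j : 'I_(n + n)) (a : R) :
    EO M -> i != j -> EO (M *m eo_elem i j a).

Definition alg_morph (R : comPzRingType) (A B : algType R) (phi : A -> B) : Prop :=
  [/\ forall x y, phi (x + y) = phi x + phi y,
      forall (a : R) x, phi (a *: x) = a *: phi x,
      forall x y, phi (x * y) = phi x * phi y &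
      phi 1 = 1].

Definition is_clifford (R : comPzRingType) (n : nat) (C : algType R)
    (j : {linear 'rV[R]_(n + n) -> C}) : Prop :=
  (forall u, j u * j u = (hq u)%:A) /\
  (forall (A : algType R) (f : {linear 'rV[R]_(n + n) -> A}),
      (forall u, f u * f u = (hq u)%:A) ->
      exists phi : C -> A,
        [/\ alg_morph phi, forall u, phi (j u) = f u &
            forall psi : C -> A, alg_morph psi -> (forall u, psi (j u) = f u) ->
              forall x, psi x = phi x]).

Definition is_canonical_involution (R : comPzRingType) (n : nat) (C : algType R)
    (j : {linear 'rV[R]_(n + n) -> C}) (star : C -> C) : Prop :=
  [/\ forall x y, star (x + y) = star x + star y,
      forall (a : R) x, star (a *: x) = a *: star x,
      forall x y, star (x * y) = star y * star x,
      star 1 = 1 &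
      forall u, star (j u) = j u].

Inductive cl_even (R : comPzRingType) (n : nat) (C : algType R)
    (j : 'rV[R]_(n + n) -> C) : C -> Prop :=
| ce1 : cl_even j 1
| ceD x y : cl_even j x -> cl_even j y -> cl_even j (x + y)
| ceZ (a : R) x : cl_even j x -> cl_even j (a *: x)
| ceM u u' x : cl_even j x -> cl_even j (j u * j u' * x).

Definition spin_with_inv (R : comPzRingType) (n : nat) (C : algType R)
    (j : 'rV[R]_(n + n) -> C) (star : C -> C) (x y : C) : Prop :=
  [/\ cl_even j x, x * star x = 1, x * y = 1, y * x = 1 &
      forall u, exists u', x * j u * y = j u'] /\
  (forall u', exists u, x * j u * y = j u').

(* Epin_{2n}(R) = pi^{-1}(EO_{2n}(R)): pi(x) is given (in the ordered basis,
   acting on row vectors) by a matrix of EO_{2n}(R) *)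
Definition epin_with_inv (R : comPzRingType) (n : nat) (C : algType R)
    (j : 'rV[R]_(n + n) -> C) (star : C -> C) (x y : C) : Prop :=
  spin_with_inv j star x y /\
  exists M : 'M[R]_(n + n), EO M /\ forall u, x * j u * y = j (u *m M).

Definition epin_orbit (R : comPzRingType) (n : nat) (C : algType R)
    (j : 'rV[R]_(n + n) -> C) (star : C -> C) (u1 u2 : 'rV[R]_(n + n)) : Prop :=
  exists x y : C, epin_with_inv j star x y /\ j u2 = x * j u1 * y.

Definition eo_orbit (R : pzRingType) (n : nat) (u1 u2 : 'rV[R]_(n + n)) : Prop :=
  exists M : 'M[R]_(n + n), EO M /\ u2 = u1 *m M.

Definition en_orbit (R : pzRingType) (n : nat) (v1 v2 : 'rV[R]_n) : Prop :=
  exists e : 'M[R]_n, En e /\ v2 = v1 *m e.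

(* Main.v *)
(* EO and Epin have the same orbits because every generator of EO lifts to Spin,
   and because [j] is injective, so that the matrix of [pi x] is determined by
   [x]; injectivity comes from the spinor representation on R^(2^n).

   On a vector (v, w) with v w^T = 1, a generator of EO acts on v by an
   elementary matrix, or fixes v, or replaces v by v + w A with A alternating of
   the form a (e_bd - e_db). In the last case v + w A = v (1 + w^T (w A)), and
   since n >= 3 the row w A has a zero entry, which makes this transvection
   elementary. Conversely En lifts to block-diagonal matrices of EO, and two
   vectors (v, w), (v, w') of the sphere differ by an alternating matrix acting
   on the second half. *)
From HB Require Import structures.
Require Import Defs.
From mathcomp Require Import all_boot all_order all_algebra.
From mathcomp Require Import ring.
Set Implicit Arguments. Unset Strict Implicit. Unset Printing Implicit Defensive.
Import GRing.Theory.
Local Open Scope ring_scope.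

(** * Generators acting on rows, and the duality of indices *)

Lemma row_mul_delta (R : comPzRingType) (m n : nat) (u : 'rV[R]_m) (i : 'I_m) (j : 'I_n) :
  u *m delta_mx i j = u 0 i *: delta_mx 0 j.
Proof.
apply/rowP => k; rewrite !mxE (bigD1 i) //= big1 ?addr0 => [|l li].
  by rewrite mxE eqxx.
by rewrite mxE (negPf li) mulr0.
Qed.

Lemma mul_elem_mx (R : comPzRingType) (n : nat) (v : 'rV[R]_n) (i j : 'I_n) (a : R) :
  v *m elem_mx i j a = v + (a * v 0 i) *: delta_mx 0 j.
Proof. by rewrite mulmxDr mulmx1 -scalemxAr row_mul_delta scalerA. Qed.

Lemma mul_eo_elem (R : comPzRingType) (n : nat) (u : 'rV[R]_(n + n)) (i j : 'I_(n + n)) (a : R) :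
  u *m eo_elem i j a =
  u + (a * u 0 i) *: delta_mx 0 j - (a * u 0 (hdual j)) *: delta_mx 0 (hdual i).
Proof.
by rewrite mulmxDr mulmx1 -scalemxAr mulmxBr !row_mul_delta scalerBr !scalerA addrA.
Qed.

Lemma hdual_lshift (n : nat) (i : 'I_n) : hdual (lshift n i) = rshift n i.
Proof. by rewrite /hdual (unsplitK (inl i)). Qed.

Lemma hdual_rshift (n : nat) (i : 'I_n) : hdual (rshift n i) = lshift n i.
Proof. by rewrite /hdual (unsplitK (inr i)). Qed.

Definition hdualE := (hdual_lshift, hdual_rshift).

Lemma hdualK (n : nat) : involutive (@hdual n).
Proof. by move=> k; case: (split_ordP k) => i ->; rewrite !hdualE. Qed.

(** * The quadratic form and its invariance under [EO] *)

Section HyperbolicSpace.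
Variables (R : comPzRingType) (n : nat).
Implicit Types (u v : 'rV[R]_(n + n)) (x y z w : 'rV[R]_n) (a c : R).

Lemma hqE u : hq u = \sum_i u 0 (lshift n i) * u 0 (rshift n i).
Proof. by rewrite /hq mxE; apply: eq_bigr => i _; rewrite !mxE. Qed.

(** A basis vector is isotropic and pairs only with its dual, so no term in [c ^+ 2] appears. *)
Lemma hq_addZ u c (k : 'I_(n + n)) :
  hq (u + c *: delta_mx 0 k) = hq u + c * u 0 (hdual k).
Proof.
rewrite !hqE; case: (split_ordP k) => b ->; rewrite hdualE.
- rewrite [LHS](bigD1 b) //= [X in _ = X + _](bigD1 b) //=.
  rewrite (eq_bigr (fun i => u 0 (lshift n i) * u 0 (rshift n i))) => [|i ib].
    by rewrite !mxE /= eqxx eq_rlshift /=; ring.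
  by rewrite !mxE /= eq_lshift eq_rlshift (negPf ib) /=; ring.
- rewrite [LHS](bigD1 b) //= [X in _ = X + _](bigD1 b) //=.
  rewrite (eq_bigr (fun i => u 0 (lshift n i) * u 0 (rshift n i))) => [|i ib].
    by rewrite !mxE /= eqxx eq_lrshift /=; ring.
  by rewrite !mxE /= eq_rshift eq_lrshift (negPf ib) /=; ring.
Qed.

Lemma hq_basis (k : 'I_(n + n)) : hq (delta_mx 0 k : 'rV[R]_(n + n)) = 0.
Proof.
have := hq_addZ 0 1 k; rewrite add0r scale1r mxE mulr0 addr0 => ->.
by rewrite hqE big1 // => i _; rewrite mxE mul0r.
Qed.

(** The two summands of a generator change [hq] by opposite amounts: as [i != k], the first one
    leaves the coordinate [i] met by the second intact. *)
Lemma hq_mul_EO (M : 'M[R]_(n + n)) u : EO M -> hq (u *m M) = hq u.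
Proof.
move=> EOM; elim: M / EOM => [|M i k a _ IH ik]; first by rewrite mulmx1.
rewrite mulmxA mul_eo_elem -scaleNr -IH; move: (u *m M) => t.
rewrite !hq_addZ hdualK !mxE eqxx (negPf ik) /=; ring.
Qed.

(** * Orbit relations and elementary transvections *)

Lemma En_mul (M N : 'M[R]_n) : En M -> En N -> En (M *m N).
Proof.
move=> EM EN; elim: N / EN => [|N i k a _ IH ik]; first by rewrite mulmx1.
by rewrite mulmxA; apply: EnM.
Qed.

Lemma EO_mul (M N : 'M[R]_(n + n)) : EO M -> EO N -> EO (M *m N).
Proof.
move=> EM EN; elim: N / EN => [|N i k a _ IH ik]; first by rewrite mulmx1.
by rewrite mulmxA; apply: EOM.
Qed.

Lemma en_orbit_refl x : en_orbit x x.
Proof. by exists 1%:M; rewrite mulmx1; split; first exact: En1. Qed.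

Lemma en_orbit_trans x y z : en_orbit x y -> en_orbit y z -> en_orbit x z.
Proof.
move=> [M [EM ->]] [N [EN ->]]; exists (M *m N).
by rewrite mulmxA; split; first exact: En_mul.
Qed.

Lemma eo_orbit_refl u : eo_orbit u u.
Proof. by exists 1%:M; rewrite mulmx1; split; first exact: EO1. Qed.

Lemma eo_orbit_trans u u' u'' : eo_orbit u u' -> eo_orbit u' u'' -> eo_orbit u u''.
Proof.
move=> [M [EM ->]] [N [EN ->]]; exists (M *m N).
by rewrite mulmxA; split; first exact: EO_mul.
Qed.

Lemma en_orbit_elem x (i k : 'I_n) a :
  i != k -> en_orbit x (x + (a * x 0 i) *: delta_mx 0 k).
Proof.
move=> ik; exists (1%:M *m elem_mx i k a); rewrite mul1mx mul_elem_mx.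
by split=> //; rewrite -[elem_mx _ _ _]mul1mx; apply: EnM => //; apply: En1.
Qed.

Lemma eo_orbit_elem u (i k : 'I_(n + n)) a : i != k ->
  eo_orbit u (u + (a * u 0 i) *: delta_mx 0 k - (a * u 0 (hdual k)) *: delta_mx 0 (hdual i)).
Proof.
move=> ik; exists (1%:M *m eo_elem i k a); rewrite mul1mx mul_eo_elem.
by split=> //; rewrite -[eo_elem _ _ _]mul1mx; apply: EOM => //; apply: EO1.
Qed.

(** The multiples of basis rows are added one at a time; since [z 0 k = 0], the entry [x 0 k] that
    scales them never changes. *)
Lemma en_orbit_add_row x z c (k : 'I_n) :
  z 0 k = 0 -> en_orbit x (x + (c * x 0 k) *: z).
Proof.
move=> zk0; rewrite [z]row_sum_delta.
pose S s : 'rV[R]_n := \sum_(i <- s) z 0 i *: delta_mx 0 i.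
have Sk s : S s 0 k = 0.
  rewrite /S summxE big1 // => i _; rewrite !mxE eqxx /=.
  by case: eqVneq => [<-|_]; rewrite ?zk0 ?mul0r ?mulr0.
suff: forall s, en_orbit x (x + (c * x 0 k) *: S s) by apply.
elim=> [|i s IH]; first by rewrite /S big_nil scaler0 addr0; apply: en_orbit_refl.
rewrite /S big_cons -/(S s); have [->|ik] := eqVneq i k.
  by rewrite zk0 scale0r add0r.
apply: (en_orbit_trans IH).
have := en_orbit_elem (x + (c * x 0 k) *: S s) (c * z 0 i) (_ : k != i).
rewrite eq_sym => /(_ ik); congr en_orbit.
rewrite 2!mxE Sk mulr0 addr0 scalerDr scalerA -addrA [in RHS](addrC _ (_ *: S s)).
by congr (_ + (_ + _ *: _)); ring.
Qed.

(** Transposed form of [en_orbit_add_row]: only the entry [k] moves, and [y 0 k = 0] keeps it out of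
    the product with [y^T]. *)
Lemma en_orbit_add_col x y c (k : 'I_n) :
  y 0 k = 0 -> en_orbit x (x + (c * (x *m y^T) 0 0) *: delta_mx 0 k).
Proof.
move=> yk0; rewrite mxE.
suff: forall s, en_orbit x (x + (c * \sum_(i <- s) x 0 i * y^T i 0) *: delta_mx 0 k).
  by apply.
elim=> [|i s IH].
  by rewrite big_nil mulr0 scale0r addr0; apply: en_orbit_refl.
rewrite big_cons; have [->|ik] := eqVneq i k; first by rewrite mxE yk0 mulr0 add0r.
apply: (en_orbit_trans IH).
have := en_orbit_elem (x + (c * \sum_(j <- s) x 0 j * y^T j 0) *: delta_mx 0 k) (c * y 0 i) ik.
congr en_orbit; rewrite !mxE (negPf ik) andbF mulr0 addr0 -addrA -scalerDl.
by congr (_ + _ *: _); ring.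
Qed.

(* Suslin: [1 + w^T z] is elementary when [z w^T = 0] and [z] has a zero entry.
   With [y] the row [w] without its [k]-th entry, it is the commutator of
   [1 + y^T e_k] and [1 + e_k^T z], multiplied by [1 + w_k e_k^T z]. *)
Lemma en_orbit_transvection x w z (k : 'I_n) :
  z 0 k = 0 -> (z *m w^T) 0 0 = 0 -> en_orbit x (x + (x *m w^T) 0 0 *: z).
Proof.
move=> zk0 zw0; pose y := w - w 0 k *: delta_mx 0 k.
have yk0 : y 0 k = 0 by rewrite !mxE !eqxx mulr1 subrr.
have dotE t : (t *m w^T) 0 0 = (t *m y^T) 0 0 + w 0 k * t 0 k.
  rewrite /y linearB linearZ /= trmx_delta mulmxBr -scalemxAr -colE !mxE.
  by rewrite addrNK.
move: y yk0 dotE => y yk0 dotE.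
have zy0 : (z *m y^T) 0 0 = 0 by move: zw0; rewrite dotE zk0 mulr0 addr0.
set s := (x *m y^T) 0 0.
have e1 := en_orbit_add_col x 1 yk0; rewrite mul1r -/s in e1.
have e2 := en_orbit_add_row (x + s *: delta_mx 0 k) 1 zk0.
rewrite !mxE !eqxx mulr1 mul1r in e2.
set x2 := (X in en_orbit _ X) in e2.
have e3 := en_orbit_add_col x2 (-1) yk0.
have x2y : (x2 *m y^T) 0 0 = s.
  rewrite /x2 !mulmxDl -!scalemxAl mxE [X in _ + X]mxE zy0 mulr0 addr0.
  rewrite mxE [X in _ + X]mxE -rowE !mxE yk0 mulr0 addr0.
  by rewrite /s mxE; apply: eq_bigr => i _; rewrite !mxE.
rewrite x2y mulN1r in e3.
have x3E : x2 + - s *: delta_mx 0 k = x + (x 0 k + s) *: z.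
  by rewrite /x2 scaleNr addrAC addrK.
rewrite x3E in e3.
(* The last factor of the commutator, of coefficient [-1], is merged with the one of coefficient
   [w 0 k]. *)
have e4 := en_orbit_add_row (x + (x 0 k + s) *: z) (w 0 k - 1) zk0.
rewrite !mxE zk0 mulr0 addr0 -addrA -scalerDl in e4.
have := en_orbit_trans (en_orbit_trans e1 e2) (en_orbit_trans e3 e4).
by congr (en_orbit _ (_ + _ *: _)); rewrite dotE -/s; ring.
Qed.

(** * From [EO]-orbits on the sphere to [En]-orbits *)

Lemma lsubmx_deltal (b : 'I_n) : lsubmx (delta_mx 0 (lshift n b) : 'rV[R]_(n + n)) = delta_mx 0 b.
Proof. by apply/rowP => k; rewrite !mxE eq_lshift. Qed.

Lemma lsubmx_deltar (b : 'I_n) : lsubmx (delta_mx 0 (rshift n b) : 'rV[R]_(n + n)) = 0.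
Proof. by apply/rowP => k; rewrite !mxE eq_lrshift. Qed.

Lemma lsubmx_addZBZ u t t' a c :
  lsubmx (u + a *: t - c *: t') = lsubmx u + a *: lsubmx t - c *: lsubmx t'.
Proof. by apply/rowP => k; rewrite !mxE. Qed.

Lemma en_orbit_eo_elem u (i k : 'I_(n + n)) a :
  (3 <= n)%N -> hq u = 1 -> i != k ->
  en_orbit (lsubmx u) (lsubmx (u *m eo_elem i k a)).
Proof.
move=> n3 qu; rewrite mul_eo_elem.
case: (split_ordP i) => b ->; case: (split_ordP k) => d ->; rewrite !hdualE.
- rewrite eq_lshift => bd; rewrite lsubmx_addZBZ.
  rewrite lsubmx_deltal lsubmx_deltar scaler0 subr0.
  by have := en_orbit_elem (lsubmx u) a bd; rewrite mxE.
- move=> _; rewrite lsubmx_addZBZ !lsubmx_deltar !scaler0 subr0 addr0.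
  exact: en_orbit_refl.
- move=> _; rewrite lsubmx_addZBZ !lsubmx_deltal.
  (* For [b = d] the two indices are dual to each other and the generator is the identity. *)
  have [->|bd] := eqVneq b d; first by rewrite addrK; apply: en_orbit_refl.
  have [l lbd] : exists l, l \notin [set b; d].
    apply/existsP; rewrite -negb_forall; apply/negP => /forallP h.
    have /subset_leq_card : [set: 'I_n] \subset [set b; d] by apply/subsetP => m _.
    by rewrite cardsT card_ord cards2 bd leqNgt n3.
  move: lbd; rewrite !inE negb_or => /andP[lb ld].
  pose w := rsubmx u; pose z : 'rV[R]_n := (a * w 0 b) *: delta_mx 0 d - (a * w 0 d) *: delta_mx 0 b.
  have zl0 : z 0 l = 0 by rewrite !mxE (negPf lb) (negPf ld) !mulr0 subr0.
  have zw0 : (z *m w^T) 0 0 = 0.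
    by rewrite mulmxBl -!scalemxAl -!rowE !mxE; ring.
  (* The coefficient of [z] in the transvection is [hq u], which is 1 on the sphere. *)
  have := en_orbit_transvection (lsubmx u) zl0 zw0; rewrite -/(hq u) qu scale1r addrA.
  by rewrite !mxE.
(* On the first half this generator acts as [elem_mx d b (- a)]. *)
- rewrite eq_rshift eq_sym => bd; rewrite lsubmx_addZBZ.
  rewrite lsubmx_deltal lsubmx_deltar scaler0 addr0.
  by have := en_orbit_elem (lsubmx u) (- a) bd; rewrite mxE mulNr scaleNr.
Qed.

Lemma eo_orbit_en_orbit u u' : (3 <= n)%N -> hq u = 1 ->
  eo_orbit u u' -> en_orbit (lsubmx u) (lsubmx u').
Proof.
move=> n3 qu [M [EOM ->]]; elim: M / EOM => [|M i k a EOM IH ik].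
  by rewrite mulmx1; apply: en_orbit_refl.
rewrite mulmxA; apply: (en_orbit_trans IH).
by apply: en_orbit_eo_elem => //; rewrite hq_mul_EO.
Qed.

(** * From [En]-orbits back to [EO]-orbits *)

(** The second half of [u'] is left unspecified; [eo_orbit_same_left] corrects it afterwards. *)
Lemma eo_orbit_lift_En u (e : 'M[R]_n) :
  En e -> exists2 u', eo_orbit u u' & lsubmx u' = lsubmx u *m e.
Proof.
move=> Ee; elim: e / Ee => [|M i k a _ [u' uu' lu'] ik].
  by exists u; [apply: eo_orbit_refl | rewrite mulmx1].
have lik : lshift n i != lshift n k by rewrite eq_lshift.
exists (u' *m eo_elem (lshift n i) (lshift n k) a).
  by apply: (eo_orbit_trans uu'); rewrite mul_eo_elem; apply: eo_orbit_elem.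
rewrite mulmxA -lu' mul_eo_elem mul_elem_mx !hdualE lsubmx_addZBZ.
by rewrite lsubmx_deltal lsubmx_deltar scaler0 subr0 mxE.
Qed.

(** This is [(v, w)] mapped to [(v, w + v A)] with [A] alternating. Each summand is one generator,
    and its coefficients involve only the first half, which stays fixed. *)
Lemma eo_orbit_add_alternating u (a : 'I_n * 'I_n -> R) (s : seq ('I_n * 'I_n)) :
  eo_orbit u (u + \sum_(p <- s) a p *: (u 0 (lshift n p.1) *: delta_mx 0 (rshift n p.2)
                                       - u 0 (lshift n p.2) *: delta_mx 0 (rshift n p.1))).
Proof.
pose S s : 'rV[R]_(n + n) := \sum_(p <- s) a p *:
  (u 0 (lshift n p.1) *: delta_mx 0 (rshift n p.2)
   - u 0 (lshift n p.2) *: delta_mx 0 (rshift n p.1)).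
have S0 t i : S t 0 (lshift n i) = 0.
  by rewrite summxE big1 // => p _; rewrite !mxE !eq_lrshift !mulr0 subr0 mulr0.
rewrite -/(S s); elim: s => [|[i k] s IH].
  by rewrite /S big_nil addr0; apply: eo_orbit_refl.
rewrite /S big_cons -/(S s) /=; have [->|ik] := eqVneq i k.
  by rewrite subrr scaler0 add0r.
apply: (eo_orbit_trans IH).
have := @eo_orbit_elem (u + S s) (lshift n i) (rshift n k) (a (i, k)).
rewrite eq_lrshift => /(_ isT); congr eo_orbit.
rewrite !hdualE ![(u + _) _ _]mxE !S0 !addr0 scalerBr !scalerA -!addrA; congr (_ + _).
by rewrite addrC -addrA.
Qed.

(* If [v w^T = v w'^T = 1] and [d = w' - w], then [w' = w + v (w^T d - d^T w)],
   and the matrix [w^T d - d^T w] is alternating. *)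
Lemma eo_orbit_same_left u u' :
  hq u = 1 -> hq u' = 1 -> lsubmx u = lsubmx u' -> eo_orbit u u'.
Proof.
move=> qu qu' uu'; pose d := rsubmx u' - rsubmx u.
have du : \sum_i d 0 i * u 0 (lshift n i) = 0.
  rewrite -[RHS](subrr 1) -{1}qu' -qu !hqE -sumrB; apply: eq_bigr => i _.
  move/rowP: uu' => /(_ i); rewrite !mxE => ->; ring.
have := eo_orbit_add_alternating u (fun p => u 0 (rshift n p.1) * d 0 p.2)
          [seq (i, k) | i <- enum 'I_n, k <- enum 'I_n].
congr eo_orbit; rewrite big_allpairs /= !big_enum /=.
pose D : 'rV[R]_(n + n) := \sum_k d 0 k *: delta_mx 0 (rshift n k).
transitivity (u + \sum_i (u 0 (lshift n i) * u 0 (rshift n i)) *: D).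
  congr (_ + _); apply: eq_bigr => i _; rewrite big_enum /= scaler_sumr.
  rewrite (eq_bigr (fun k => (u 0 (lshift n i) * u 0 (rshift n i)) *: (d 0 k *: delta_mx 0 (rshift n k))
     - (d 0 k * u 0 (lshift n k)) *: (u 0 (rshift n i) *: delta_mx 0 (rshift n i)))).
    by rewrite sumrB -scaler_suml du scale0r subr0.
  by move=> k _; rewrite scalerBr !scalerA; congr (_ *: _ - _ *: _); ring.
rewrite -scaler_suml -hqE qu scale1r; apply/rowP => k; rewrite mxE summxE.
case: (split_ordP k) => b ->.
  rewrite big1 ?addr0 => [|i _]; last by rewrite !mxE eq_lrshift mulr0.
  by move/rowP: uu' => /(_ b); rewrite !mxE.
rewrite (bigD1 b) //= big1 ?addr0 => [|i ib].
  by rewrite !mxE !eqxx mulr1 addrC subrK.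
by rewrite !mxE eq_rshift eq_sym (negPf ib) mulr0.
Qed.

Lemma eo_orbitE u u' : (3 <= n)%N -> hq u = 1 -> hq u' = 1 ->
  eo_orbit u u' <-> en_orbit (lsubmx u) (lsubmx u').
Proof.
move=> n3 qu qu'; split; first exact: eo_orbit_en_orbit.
move=> [e [Ee u'e]]; have [t ut te] := eo_orbit_lift_En u Ee.
apply: (eo_orbit_trans ut); apply: eo_orbit_same_left => //; last by rewrite te.
by case: ut => M [EOM ->]; rewrite hq_mul_EO.
Qed.

End HyperbolicSpace.

(** * The spinor representation by matrices *)

Lemma matrix1_neq0 (R : pzSemiRingType) (k : nat) :
  (1 : R) != 0 -> (1%:M : 'M[R]_k.+1) != 0.
Proof. by apply: contra_neq => /matrixP/(_ 0 0); rewrite !mxE. Qed.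

(* The library makes matrices an [algType] only over a [comNzRingType]. *)
Section MatrixAlgebra.
Variables (R : comPzRingType) (R1 : (1 : R) != 0) (k : nat).

(** The proof of [1 != 0] is an argument of the type, so that its instances can use it. *)
Definition nz_matrix of (1 : R) != 0 := 'M[R]_k.+1.
HB.instance Definition _ := GRing.PzRing.on (nz_matrix R1).
HB.instance Definition _ :=
  GRing.PzSemiRing_isNonZero.Build (nz_matrix R1) (matrix1_neq0 k R1).
HB.instance Definition _ := GRing.Lmodule.on (nz_matrix R1).
HB.instance Definition _ :=
  GRing.LSemiModule_isLSemiAlgebra.Build R (nz_matrix R1) (@scalemxAl R _ _ _).
HB.instance Definition _ :=
  GRing.LSemiAlgebra_isSemiAlgebra.Build R (nz_matrix R1) (fun a => scalemxAr a).

End MatrixAlgebra.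

Section Clifford.
Variables (R : comPzRingType) (n : nat).

(** Adjoins a hyperbolic plane: the off-diagonal part has square [a * b] and anticommutes with
    [diag(A, -A)]. *)
Definition double_block m (A : 'M[R]_m) (a b : R) : 'M[R]_(m + m) :=
  block_mx A a%:M b%:M (- A).

Lemma double_block_linear m (A B : 'M[R]_m) (c a b a' b' : R) :
  double_block (c *: A + B) (c * a + a') (c * b + b') =
  c *: double_block A a b + double_block B a' b'.
Proof.
rewrite /double_block scale_block_mx add_block_mx !raddfD /= !scale_scalar_mx.
by rewrite scalerN.
Qed.

Lemma double_block_sq m (A : 'M[R]_m) (q a b : R) :
  A *m A = q%:M ->
  double_block A a b *m double_block A a b = (q + a * b)%:M.
Proof.
move=> AA; rewrite mulmx_block !mulmxN !mulNmx opprK AA !mul_scalar_mx !mul_mx_scalar.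
rewrite !subrr !scale_scalar_mx (mulrC b) (addrC (a * b)%:M) -raddfD /=.
by rewrite -scalar_mx_block.
Qed.

(* For [s = enum 'I_n] this is the spinor representation on [R^(2^n)]. *)
Lemma matrix_sqrt_partial_hq (s : seq 'I_n) :
  exists k (f : 'rV[R]_(n + n) -> 'M[R]_k.+1), linear f /\
    forall u, f u *m f u = (\sum_(i <- s) u 0 (lshift n i) * u 0 (rshift n i))%:M.
Proof.
elim: s => [|i s [k [f [lf sqf]]]].
  exists 0, (fun=> 0); split=> [a u v|u]; first by rewrite scaler0 addr0.
  by rewrite big_nil mul0mx raddf0.
(* The size [(k + k.+1).+1] is convertible to [k.+1 + k.+1]. *)
exists (k + k.+1)%N, (fun u => double_block (f u) (u 0 (lshift n i)) (u 0 (rshift n i))).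
split=> [a u v|u].
  by rewrite lf !mxE; apply: (@double_block_linear k.+1).
by rewrite big_cons addrC; apply: (@double_block_sq k.+1).
Qed.

(* The spinor representation factors through [C] and is faithful on scalars. *)
Lemma scalar_clifford_inj (C : algType R) (j : {linear 'rV[R]_(n + n) -> C}) (a : R) :
  is_clifford j -> a%:A = 0 :> C -> a = 0.
Proof.
move=> [_ univ] aC0.
have R1 : (1 : R) != 0.
  apply/eqP => R10; have := oner_neq0 C.
  by rewrite -[1 : C]scale1r R10 scale0r eqxx.
have [k [f [lf sqf]]] := matrix_sqrt_partial_hq (index_enum 'I_n).
pose f' : {linear 'rV[R]_(n + n) -> nz_matrix k R1} :=
  HB.pack f (GRing.isLinear.Build R _ (nz_matrix k R1) _ f lf).
have [phi [[_ phiZ _ phi1] _ _]] : exists phi : C -> nz_matrix k R1,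
    [/\ alg_morph phi, forall u, phi (j u) = f' u &
        forall psi : C -> nz_matrix k R1, alg_morph psi -> (forall u, psi (j u) = f' u) ->
          forall x, psi x = phi x].
  apply: univ => u; rewrite -[LHS]/(f u *m f u) sqf -hqE.
  by rewrite -[RHS]/(hq u *: 1%:M) scalemx1.
have : phi a%:A = a *: 1%:M :> 'M[R]_k.+1 by rewrite phiZ phi1.
have phi0 : phi 0 = 0 by have := phiZ 0 0; rewrite !scale0r.
by rewrite aC0 phi0 => /matrixP/(_ 0 0); rewrite !mxE mulr1.
Qed.

(** * Relations in the Clifford algebra *)

Section CliffordAlgebra.
Variables (C : algType R) (j : {linear 'rV[R]_(n + n) -> C}).
Hypothesis cliffordC : is_clifford j.
Implicit Types (u : 'rV[R]_(n + n)) (k : 'I_(n + n)).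

Let e k : 'rV[R]_(n + n) := delta_mx 0 k.

Lemma clifford_sq u : j u * j u = (hq u)%:A.
Proof. by case: cliffordC. Qed.

Lemma clifford_sq_basis k : j (e k) * j (e k) = 0.
Proof. by rewrite clifford_sq hq_basis scale0r. Qed.

(** Polarization of [clifford_sq] at [u + e k]. *)
Lemma clifford_basis_anticomm u k : j u * j (e k) + j (e k) * j u = (u 0 (hdual k))%:A.
Proof.
have := clifford_sq (u + e k); rewrite -[in hq _](scale1r (e k)) hq_addZ mul1r.
rewrite linearD mulrDl !mulrDr clifford_sq_basis addr0 clifford_sq scalerDl.
by rewrite -addrA => /addrI.
Qed.

(** The anticommutator with [e (hdual k)] recovers the coordinate [k] as a scalar of [C], and
    scalars embed in [C]. *)
Lemma clifford_inj : injective j.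
Proof.
move=> u v uv; apply/eqP; rewrite -subr_eq0; apply/eqP/rowP => k.
rewrite [RHS]mxE; apply: (scalar_clifford_inj cliffordC).
by rewrite -[k]hdualK -clifford_basis_anticomm linearB uv subrr mul0r mulr0 addr0.
Qed.

(** With [N = Q * P], the commutator of [N] and [U] is [b *: Q - c *: P] and [N * U * N = 0], so
    conjugation by [1 + a *: N] is affine in [a]. *)
Lemma conj_isotropic_pair (P Q U : C) (a b c : R) :
  P * P = 0 -> Q * Q = 0 -> Q * P + P * Q = 0 ->
  U * P + P * U = b%:A -> U * Q + Q * U = c%:A ->
  (1 + a *: (Q * P)) * U * (1 - a *: (Q * P)) = U + (a * b) *: Q - (a * c) *: P.
Proof.
move=> PP QQ /eqP; rewrite addr_eq0 => /eqP QP UP UQ.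
have PU : P * U = b%:A - U * P by rewrite -UP addrC addKr.
have QU : Q * U = c%:A - U * Q by rewrite -UQ addrC addKr.
have QPU : Q * P * U = b *: Q - c *: P + U * (Q * P).
  rewrite -mulrA PU mulrBr (mulrA Q U) QU mulrBl -scalerAr mulr1 -scalerAl mul1r.
  by rewrite opprB addrCA addrC -mulrA -addrA addrC -addrA addrC.
have QQP : Q * (Q * P) = 0 by rewrite mulrA QQ mul0r.
have PQP : P * (Q * P) = 0 by rewrite QP mulrN mulrA PP mul0r oppr0.
have QPUQP : Q * P * U * (Q * P) = 0.
  rewrite QPU !mulrDl mulNr -!scalerAl QQP PQP -!mulrA PQP !mulr0.
  by rewrite !scaler0 subr0 addr0.
rewrite mulrDl mul1r mulrBr mulr1 mulrDl -!scalerAr -!scalerAl QPUQP !scaler0 addr0.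
by rewrite QPU !scalerDr scalerN !scalerA addrA addrK addrA.
Qed.

End CliffordAlgebra.

(** * Lifting [EO] to the spin group *)

Lemma cl_even_mul (C : algType R) (j : 'rV[R]_(n + n) -> C) x y :
  cl_even j x -> cl_even j y -> cl_even j (x * y).
Proof.
move=> ex ey; elim: x / ex => [|x x' _ IH _ IH'|a x _ IH|u u' x _ IH].
- by rewrite mul1r.
- by rewrite mulrDl; apply: ceD.
- by rewrite -scalerAl; apply: ceZ.
- by rewrite -!mulrA mulrA; apply: ceM.
Qed.

Section Epin.
Variables (C : algType R) (j : {linear 'rV[R]_(n + n) -> C}) (star : C -> C).
Hypotheses (cliffordC : is_clifford j) (starP : is_canonical_involution j star).

Lemma spin1 : spin_with_inv j star 1 1.
Proof.
have [_ _ _ star1 _] := starP.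
split; last by move=> u; exists u; rewrite mul1r mulr1.
split; rewrite ?star1 ?mulr1 //; first exact: ce1.
by move=> u; exists u; rewrite mul1r mulr1.
Qed.

(** Conjugations compose on the left while matrices act on rows from the right, hence the order
    [x' * x]. *)
Lemma spin_mul x y x' y' :
  spin_with_inv j star x y -> spin_with_inv j star x' y' ->
  spin_with_inv j star (x' * x) (y * y').
Proof.
have [_ _ starM _ _] := starP.
move=> [[ex sx xy yx jx] jx'] [[ex' sx' xy' yx' jxx] jxx'].
have conjM t : x' * x * t * (y * y') = x' * (x * t * y) * y' by rewrite !mulrA.
split; last first.
  move=> u; have [t tu] := jxx' u; have [s st] := jx' t.
  by exists s; rewrite conjM st.
split.
- exact: cl_even_mul.
- by rewrite starM !mulrA -(mulrA x') sx mulr1.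
- by rewrite !mulrA -(mulrA x') xy mulr1.
- by rewrite !mulrA -(mulrA y) yx' mulr1.
- move=> u; have [t tu] := jx u; have [s st] := jxx t.
  by exists s; rewrite conjM tu.
Qed.

(* The lift is [1 + a e_k e_(hdual i)]: these two vectors are isotropic and
   orthogonal, so that the second summand squares to zero. *)
Lemma spin_lift_eo_elem (i k : 'I_(n + n)) (a : R) : i != k ->
  exists x y : C, spin_with_inv j star x y /\
    forall u, x * j u * y = j (u *m eo_elem i k a).
Proof.
move=> ik; have [starD starZ starM star1 starj] := starP.
pose P := j (delta_mx 0 (hdual i)); pose Q := j (delta_mx 0 k).
have PP : P * P = 0 by apply: clifford_sq_basis.
have QQ : Q * Q = 0 by apply: clifford_sq_basis.
have QP : Q * P + P * Q = 0.
  by rewrite clifford_basis_anticomm // hdualK mxE (negPf ik) andbF scale0r.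
have QPQP : Q * P * (Q * P) = 0.
  have /eqP := QP; rewrite addr_eq0 => /eqP {2}->.
  by rewrite mulrN -mulrA (mulrA P) PP mul0r mulr0 oppr0.
have conjE c u : (1 + c *: (Q * P)) * j u * (1 - c *: (Q * P)) = j (u *m eo_elem i k c).
  rewrite mul_eo_elem linearB linearD !linearZ /= !scalerN; apply: conj_isotropic_pair => //.
  - by rewrite clifford_basis_anticomm // hdualK.
  - exact: clifford_basis_anticomm.
have inv c : (1 + c *: (Q * P)) * (1 - c *: (Q * P)) = 1.
  rewrite mulrDl mul1r mulrBr mulr1 -scalerAl -scalerAr QPQP !scaler0 subr0.
  by rewrite subrK.
have invN c : (1 - c *: (Q * P)) * (1 + c *: (Q * P)) = 1.
  by have := inv (- c); rewrite scaleNr opprK.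
exists (1 + a *: (Q * P)), (1 - a *: (Q * P)); split; last exact: conjE.
split.
  split=> [||||u]; [| |exact: inv |exact: invN | by exists (u *m eo_elem i k a)].
  - apply: ceD; first exact: ce1.
    by apply: ceZ; rewrite -[_ * P]mulr1; apply/ceM/ce1.
  (* [star] turns [Q * P] into [P * Q = - (Q * P)], hence the lift into its inverse. *)
  - rewrite starD starZ starM !starj star1.
    by have /eqP := QP; rewrite addrC addr_eq0 => /eqP ->; rewrite scalerN inv.
(* Surjectivity: conjugation by the inverse lift is the generator of parameter [- a]. *)
move=> u; exists (u *m eo_elem i k (- a)); rewrite -conjE scaleNr opprK.
by rewrite !mulrA inv mul1r -mulrA inv mulr1.
Qed.

Lemma spin_lift_EO (M : 'M[R]_(n + n)) : EO M ->
  exists x y : C, spin_with_inv j star x y /\ forall u, x * j u * y = j (u *m M).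
Proof.
move=> EOM; elim: M / EOM => [|M i k a _ [x [y [sxy xyM]]] ik].
  exists 1, 1; split=> [|u]; first exact: spin1.
  by rewrite mul1r mulr1 mulmx1.
have [x' [y' [sxy' xyE]]] := spin_lift_eo_elem a ik.
exists (x' * x), (y * y'); split; first exact: spin_mul.
by move=> u; rewrite mulmxA -xyE -xyM !mulrA.
Qed.

Lemma epin_orbitE u1 u2 : epin_orbit j star u1 u2 <-> eo_orbit u1 u2.
Proof.
split=> [[x [y [[_ [M [EOM xyM]]] u2E]]] | [M [EOM ->]]].
  by exists M; split=> //; apply: (clifford_inj cliffordC); rewrite u2E.
have [x [y [sxy xyM]]] := spin_lift_EO EOM.
by exists x, y; split; [split=> //; exists M | rewrite xyM].
Qed.

End Epin.
End Clifford.

Theorem theorem4p4 (R : comPzRingType) (n : nat) (C : algType R)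
    (j : {linear 'rV[R]_(n + n) -> C}) (star : C -> C) :
  (3 <= n)%N ->
  is_clifford j -> is_canonical_involution j star ->
  forall u1 u2 : 'rV[R]_(n + n),
    unit_sphere u1 -> unit_sphere u2 ->
    (epin_orbit j star u1 u2 <-> en_orbit (lsubmx u1) (lsubmx u2)) /\
    (epin_orbit j star u1 u2 <-> eo_orbit u1 u2).
Proof.
move=> n3 cliffordC starP u1 u2 q1 q2; rewrite -(eo_orbitE n3 q1 q2).
by split; apply: epin_orbitE.
Qed.
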